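(* Let $C>1$ be a real number, let $\epsilon>0$, and let $\theta:\mathbb{Z}\to\mathbb{Z}^+$ be any function satisfying $\theta(n)\leq |n|/C$ for all $n\in\mathbb{Z}$. Then there exists $f\in l^1(\mathbb{Z})$, not identically zero, such that for the sets $$K_{C,N,\theta}:=\{n\in\mathbb{Z}:\ |n|\leq N,\ \mathcal{F}f(n)\leq\theta(n)\},$$ where $\mathcal{F}f$ is the discrete frequency function of $f$, the quantity $$\frac{|K_{C,N,\theta}|\,\log^{1+\epsilon}N}{N}$$ does not converge to $0$ as $N\to\infty$.
   Context: $\mathbb{Z}^+$ denotes the set of non-negative integers (including $0$). $l^1(\mathbb{Z})$ is the space of absolutely summable (real- or complex-valued) functions on $\mathbb{Z}$. $|K|$ denotes the cardinality of a finite set $K$, and $\log^{a}N=(\log N)^{a}$. For $f\in l^1(\mathbb{Z})$, $n\in\mathbb{Z}$ and $r\in\mathbb{Z}^+$ put $$\mathcal{A}_rf(n):=\frac{1}{2r+1}\sum_{k=-r}^{r}|f(n+k)|,\qquad \mathcal{M}f(n):=\sup_{r\in\mathbb{Z}^+}\mathcal{A}_rf(n),$$ $$E_{f,n}:=\{r\in\mathbb{Z}^+:\ \mathcal{M}f(n)=\mathcal{A}_rf(n)\}.$$ The set $E_{f,n}$ is always non-empty, and the discrete frequency function is $\mathcal{F}f(n):=\inf E_{f,n}$, i.e. the smallest $r\in\mathbb{Z}^+$ for which the supremum defining $\mathcal{M}f(n)$ is attained. *)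

(* Defs.v *)
From HB Require Import structures.
From mathcomp Require Import all_boot all_order all_algebra finmap.
From mathcomp Require Import all_classical all_reals all_analysis.
Set Implicit Arguments.
Unset Strict Implicit.
Unset Printing Implicit Defensive.
Import Order.TTheory GRing.Theory Num.Theory.
Import numFieldNormedType.Exports.
Local Open Scope classical_set_scope.
Local Open Scope ring_scope.

(* The summation index k in [-r, r] is encoded as k = i - r with i <= 2r. *)
Definition avg (R : realType) (f : int -> R) (r : nat) (n : int) : R :=
  (2 * r + 1)%:R^-1 * \sum_(i < (2 * r + 1)%N) `|f (n + (i%:Z - r%:Z))|.

Definition maximal (R : realType) (f : int -> R) (n : int) : \bar R :=
  ereal_sup [set (avg f r n)%:E | r in [set: nat]].

Definition attaining (R : realType) (f : int -> R) (n : int) : set nat :=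
  [set r | maximal f n = (avg f r n)%:E].

(* The infimum is taken in the extended reals, so that it would be +oo, rather
   than a spurious 0, if the supremum were not attained; for summable f it is
   always attained and the value is the least element of [attaining f n]. *)
Definition frequency (R : realType) (f : int -> R) (n : int) : \bar R :=
  ereal_inf [set (r%:R : R)%:E | r in attaining f n].

Definition low_frequency (R : realType) (f : int -> R) (theta : int -> nat)
    (N : nat) : set int :=
  [set n | `|n| <= N%:Z /\ (frequency f n <= ((theta n)%:R : R)%:E)%E].

(* Main.v *)
(** Let f be 1/B_j on the j-th block [B_j, B_j + m_j) and 0 elsewhere, with
    B_j = 2^(4^(j+1)) and m_j = B_j / 2^(j+1), so f has norm at most 1.
    At a point of the j-th block the supremum is attained at r = 0: a window
    reaching a value larger than 1/B_j must have 2r >= B_j, and then its average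
    is at most 1/(2r+1) <= 1/B_j.  Hence the frequency vanishes on every block,
    whatever theta is, and for N = 2 B_j the quantity is at least
    (m_j / N) log N, which is of order 2^j. *)

Require Import Defs.
From HB Require Import structures.
From mathcomp Require Import all_boot all_order all_algebra finmap.
From mathcomp Require Import all_classical all_reals all_analysis.
From mathcomp Require Import zify lra.
Set Implicit Arguments.
Unset Strict Implicit.
Unset Printing Implicit Defensive.
Import Order.TTheory GRing.Theory Num.Theory.
Import numFieldNormedType.Exports.
Local Open Scope classical_set_scope.
Local Open Scope ring_scope.

(** * Lacunary blocks and their separation *)

Definition block_start (j : nat) : nat := (2 ^ 4 ^ j.+1)%N.
(** The density [2 ^- j.+1] makes the masses summable, yet loses to the logarithm of
    [block_start j], which is of order [4 ^ j]. *)
Definition block_length (j : nat) : nat := (2 ^ (4 ^ j.+1 - j.+1))%N.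
Definition block (j : nat) : seq int :=
  [seq Posz k | k <- iota (block_start j) (block_length j)].

(* Each point n lies in at most one block, whose index is smaller than |n|. *)
Definition block_function (R : realType) (n : int) : R :=
  if [pick j : 'I_`|n|%N | n \in block j] is Some j
  then (block_start j)%:R^-1 else 0.

Lemma block_start_gt0 (j : nat) : (0 < block_start j)%N.
Proof. by rewrite expn_gt0. Qed.

Lemma ltn_block_start (j : nat) : (j < block_start j)%N.
Proof.
have h1 := ltn_expl j.+1 (isT : (1 < 4)%N).
have h2 := ltn_expl (4 ^ j.+1) (isT : (1 < 2)%N).
by rewrite /block_start; lia.
Qed.

Lemma block_length_start (j : nat) :
  (block_length j * 2 ^ j.+1 = block_start j)%N.
Proof.
have h1 := ltn_expl j.+1 (isT : (1 < 4)%N).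
by rewrite -expnD subnK // ltnW.
Qed.

Lemma block_length_le (j : nat) : (block_length j <= block_start j)%N.
Proof. by rewrite leq_exp2l // leq_subr. Qed.

(** The factor 4 leaves room for halving: block [i] ends by [2 * block_start i], at most half of any
    later start. *)
Lemma block_start_grow (i j : nat) :
  (i < j)%N -> (4 * block_start i <= block_start j)%N.
Proof.
move=> ij; rewrite -[4%N]/(2 ^ 2)%N -expnD leq_exp2l //.
have : (4 ^ i.+2 <= 4 ^ j.+1)%N by rewrite leq_exp2l.
rewrite expnS; have : (0 < 4 ^ i.+1)%N by rewrite expn_gt0.
lia.
Qed.

Lemma mem_block (n : int) (j : nat) :
  (n \in block j) =
  ((block_start j)%:Z <= n < (block_start j + block_length j)%:Z).
Proof.
case: n => n; last first.
  by have /negPf -> : Negz n \notin block j by apply/negP => /mapP[].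
by rewrite mem_map ?mem_iota; [lia | move=> ? ? []].
Qed.

Lemma block_uniq (j : nat) : uniq (block j).
Proof. by rewrite map_inj_uniq ?iota_uniq // => ? ? []. Qed.

Lemma size_block (j : nat) : size (block j) = block_length j.
Proof. by rewrite size_map size_iota. Qed.

Lemma block_index (n : int) (j : nat) : n \in block j -> (j < `|n|)%N.
Proof. by rewrite mem_block; have := ltn_block_start j; lia. Qed.

Lemma block_inj (n : int) (i j : nat) : n \in block i -> n \in block j -> i = j.
Proof.
have h a b : n \in block a -> n \in block b -> ~~ (a < b)%N.
  rewrite !mem_block => ha hb; apply/negP => /block_start_grow hab.
  by have := block_length_le a; have := block_start_gt0 a; lia.
move=> hi hj; have := h _ _ hi hj; have := h _ _ hj hi; lia.
Qed.

(** * Mass and pointwise bounds of the block function *)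

Section BlockFunction.
Variable R : realType.
Local Notation f := (@block_function R).

Lemma block_function_ge0 (n : int) : 0 <= f n.
Proof. by rewrite /block_function; case: pickP => // j _; rewrite invr_ge0. Qed.

Lemma block_functionE (n : int) (j : nat) :
  n \in block j -> f n = (block_start j)%:R^-1.
Proof.
move=> nj; rewrite /block_function; case: pickP => [i ni|].
  by rewrite (block_inj ni nj).
by move=> /(_ (Ordinal (block_index nj))); rewrite nj.
Qed.

Lemma block_function_le_sum (J : nat) (n : int) : (`|n| <= J)%N ->
  f n <= \sum_(j < J) (n \in block j)%:R / (block_start j)%:R.
Proof.
move=> nJ; rewrite /block_function; case: pickP => [j nj|_]; last first.
  by apply: sumr_ge0 => j _; rewrite divr_ge0.
rewrite (bigD1 (widen_ord nJ j)) //= nj mul1r lerDl.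
by apply: sumr_ge0 => i _; rewrite divr_ge0.
Qed.

Lemma sum_mem_block (s : seq int) (j : nat) : uniq s ->
  (\sum_(x <- s) (x \in block j) <= block_length j)%N.
Proof.
move=> us; rewrite -big_mkcond /= sum1_count -size_filter -size_block.
apply: uniq_leq_size; rewrite ?filter_uniq // => x.
by rewrite mem_filter => /andP[].
Qed.

Lemma sum_half_powers (J : nat) : \sum_(j < J) (2 ^- j.+1 : R) = 1 - 2 ^- J.
Proof.
elim: J => [|J IH]; first by rewrite big_ord0 expr0 invr1 subrr.
by rewrite big_ord_recr /= IH exprS invfM; lra.
Qed.

(** Block [j] contributes at most [2 ^- j.+1], a geometric series. Lists of distinct points serve
    both for summability and for averaging windows. *)
Lemma block_function_sum_le1 (s : seq int) : uniq s -> \sum_(x <- s) f x <= 1.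
Proof.
move=> us; pose J := (\max_(x <- s) `|x|)%N.
have hJ x : x \in s -> (`|x| <= J)%N.
  by move=> xs; apply: (@leq_bigmax_seq _ _ xpredT (fun x : int => `|x|%N)).
apply: (@le_trans _ _ (\sum_(x <- s) \sum_(j < J)
    (x \in block j)%:R / (block_start j)%:R)).
  rewrite big_seq [leRHS]big_seq; apply: ler_sum => x /hJ.
  exact: block_function_le_sum.
rewrite exchange_big /=; apply: (@le_trans _ _ (\sum_(j < J) 2 ^- j.+1)).
  apply: ler_sum => j _; rewrite -mulr_suml -natr_sum.
  rewrite ler_pdivrMr ?ltr0n ?block_start_gt0 //.
  rewrite -(block_length_start j) natrM natrX mulrCA.
  rewrite mulVf ?expf_neq0 ?pnatr_eq0 // mulr1.
  by rewrite ler_nat sum_mem_block.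
by rewrite sum_half_powers lerBlDr lerDl invr_ge0 exprn_ge0.
Qed.

(** Such an [n] lies beyond every block of index below [j], and later blocks carry smaller
    values. *)
Lemma block_function_le (j : nat) (n : int) :
  (block_start j)%:Z <= 2 * n -> f n <= (block_start j)%:R^-1.
Proof.
move=> jn; rewrite /block_function; case: pickP => [i|_]; last first.
  by rewrite invr_ge0.
rewrite mem_block => ni.
rewrite lef_pV2 ?posrE ?ltr0n ?block_start_gt0 // ler_nat.
have := block_length_le i; have := block_start_gt0 i.
case: (ltngtP i j) => [/block_start_grow|/block_start_grow|->] //; lia.
Qed.

(** * Zero frequency on the blocks, and summability *)

Lemma avg0 (g : int -> R) (n : int) : avg g 0 n = `|g n|.
Proof. by rewrite /avg muln0 add0n big_ord1 invr1 mul1r subrr addr0. Qed.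

Lemma frequency_le0 (g : int -> R) (n : int) :
  (forall r, avg g r n <= `|g n|) -> (frequency g n <= 0)%E.
Proof.
move=> h; apply: ereal_inf_lbound; exists 0%N => //=.
rewrite /attaining /= avg0; apply/eqP; rewrite eq_le; apply/andP; split.
  by apply: ge_ereal_sup => _ [r _ <-]; rewrite lee_fin.
by apply: ereal_sup_ubound; exists 0%N => //; rewrite avg0.
Qed.

Lemma avg_block_function_le (n : int) (j r : nat) :
  n \in block j -> avg f r n <= `|f n|.
Proof.
move=> nj; rewrite [leRHS]ger0_norm ?block_function_ge0 // (block_functionE nj).
have B0 : 0 < (block_start j)%:R :> R by rewrite ltr0n block_start_gt0.
have r0 : 0 < (2 * r + 1)%:R :> R by rewrite ltr0n addn1.
rewrite /avg; under eq_bigr do rewrite ger0_norm ?block_function_ge0 //.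
rewrite mulrC ler_pdivrMr //.
(* A long window is controlled by the total mass 1; a short one stays right of [block_start j / 2],
   where the pointwise bound applies. *)
have [jr|rj] := leqP (block_start j) (2 * r)%N.
  rewrite -(big_mkord xpredT (fun i => f (n + (i%:Z - r%:Z)))).
  rewrite -(big_map (fun i : nat => n + (i%:Z - r%:Z)) xpredT f).
  apply: (le_trans (block_function_sum_le1 _)).
    by rewrite map_inj_uniq ?iota_uniq // => a b; lia.
  by rewrite ler_pdivlMl // mulr1 ler_nat; lia.
apply: (@le_trans _ _ (\sum_(i < (2 * r + 1)%N) (block_start j)%:R^-1)).
  apply: ler_sum => i _; apply: block_function_le.
  by move: nj; rewrite mem_block; lia.
by rewrite sumr_const card_ord mulr_natr.
Qed.

Lemma summable_block_function : summable [set: int] (fun n => (f n)%:E).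
Proof.
rewrite /summable; apply: (@le_lt_trans _ _ 1%E); last exact: ltry.
apply: ge_ereal_sup => _ [A [finA _] <-].
rewrite fsbig_finite //=.
under eq_bigr do rewrite ger0_norm ?block_function_ge0 //.
by rewrite sumEFin lee_fin block_function_sum_le1 ?fset_uniq.
Qed.

(** * Counting points of low frequency against the logarithm *)

Lemma finite_low_frequency (g : int -> R) (theta : int -> nat) (N : nat) :
  finite_set (low_frequency g theta N).
Proof.
apply: (@sub_finite_set _ _ [set` [seq i%:Z - N%:Z | i <- iota 0 (2 * N + 1)]]).
  move=> n [nN _] /=; apply/mapP; exists (absz (n + N%:Z)); last by lia.
  by rewrite mem_iota; lia.
exact: finite_seq.
Qed.

Lemma card_low_frequency_ge (theta : int -> nat) (j : nat) :
  (block_length j <=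
   #|` fset_set (low_frequency f theta (2 * block_start j))|)%N.
Proof.
rewrite -size_block; apply: uniq_leq_size; first exact: block_uniq.
move=> n nj; rewrite in_fset_set; last exact: finite_low_frequency.
rewrite inE; split.
  by move: nj; rewrite mem_block; have := block_length_le j; lia.
apply: (@le_trans _ _ 0%E); last by rewrite lee_fin.
by apply: frequency_le0 => r; exact: avg_block_function_le nj.
Qed.

Lemma ln2_ge_half : 2^-1 <= ln 2 :> R.
Proof.
(* The inequality [ln (1 + x) <= x] at [x = -1/2], where [1 + x] is the inverse of 2. *)
have : ln (1 + - 2^-1) <= - 2^-1 :> R by apply: le_ln1Dx; lra.
have -> : 1 + - 2^-1 = 2^-1 :> R by lra.
by rewrite lnV ?posrE // lerN2.
Qed.

Lemma ln_block_start_ge (j : nat) :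
  (4 ^ j.+1).+1%:R / 2 <= ln (2 * block_start j)%:R :> R.
Proof.
rewrite /block_start -expnS natrX lnXn // -[leRHS]mulr_natl.
by rewrite ler_wpM2l // ln2_ge_half.
Qed.

Lemma low_frequency_ratio_ge (eps : R) (theta : int -> nat) (j N : nat) :
  0 <= eps -> N = (2 * block_start j)%N ->
  2^-1 <= #|` fset_set (low_frequency f theta N)|%:R
            * (ln (N%:R : R)) `^ (1 + eps) / N%:R.
Proof.
move=> eps0 NE.
have N0 : 0 < N%:R :> R by rewrite NE ltr0n muln_gt0 block_start_gt0.
have q1 : 1 <= 4 ^+ j :> R by rewrite exprn_ege1 // ler1n.
have L : 2 * 4 ^+ j <= ln (N%:R : R).
  rewrite NE; apply: le_trans (ln_block_start_ge j).
  by rewrite -[(4 ^ j.+1).+1%:R]natr1 natrX exprS; lra.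
(* As [ln N >= 1], the exponent [1 + eps] only increases it. *)
have Lp : 2 * 4 ^+ j <= ln (N%:R : R) `^ (1 + eps).
  by apply: (le_trans L); apply: le1r_powR; lra.
rewrite ler_pdivlMr //.
apply: (@le_trans _ _ ((block_length j)%:R * (2 * 4 ^+ j))); last first.
  by apply: ler_pM => //; rewrite NE ler_nat card_low_frequency_ge.
(* After cancelling the block length, [2 ^ j.+1 <= 2 * 4 ^ j] remains. *)
rewrite NE -(block_length_start j) 2!natrM mulKf // ler_wpM2l //.
rewrite natrX exprS ler_pM2l // lerXn2r ?nnegrE //; lra.
Qed.

End BlockFunction.

Theorem mainTheorem3 (R : realType) (C : R) (hC : 1 < C)
  (eps : R) (heps : 0 < eps)
  (theta : int -> nat)
  (htheta : forall n : int, (theta n)%:R <= `|n|%:~R / C) :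
  exists f : int -> R,
    summable [set: int] (fun n => (f n)%:E) /\
    (exists n : int, f n != 0) /\
    ~ ((fun N : nat =>
          #|` fset_set (low_frequency f theta N)|%:R
            * (ln (N%:R : R)) `^ (1 + eps) / N%:R) @ \oo --> (0 : R)).
Proof.
exists (@block_function R); split; first exact: summable_block_function.
split.
  exists (block_start 0); rewrite (@block_functionE _ _ 0) //.
  by rewrite invr_eq0 pnatr_eq0 -lt0n block_start_gt0.
move=> /cvgrPdist_lt /(_ 2^-1); rewrite invr_gt0 => /(_ (ltr0n _ 2)) [J _ hJ].
(* The threshold [J] itself serves as block index: [N = 2 * block_start J] lies past it, and there
   the ratio is at least 1/2. *)
have /hJ : (J <= 2 * block_start J)%N by have := ltn_block_start J; lia.
rewrite sub0r normrN => /(le_lt_trans (ler_norm _)).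
by rewrite ltNge (low_frequency_ratio_ge _ (ltW heps) erefl).
Qed.
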